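(* For every $\gamma\in\mathbb{N}_0$, $f_\gamma=N_\gamma(3\gamma)$.
   Context: Let $\mathbb{N}_0$ be the set of nonnegative integers. A numerical semigroup $S$ is a submonoid of $(\mathbb{N}_0,+)$ whose set of gaps $G(S)=\mathbb{N}_0\setminus S$ is finite; its genus is $\#G(S)$. $\mathcal{S}_\gamma$ is the set of numerical semigroups of genus $\gamma$. $N_\gamma(g)$ is the number of numerical semigroups of genus $g$ having exactly $\gamma$ even gaps. For a numerical semigroup $S$, a (finite) set $B\subseteq\mathbb{N}_0$ is called $S$-closed if for all $b\in B$ and $s\in S$ either $b+s\in B$ or $b+s>\max(B)$. $C(S,i)$ is the collection of $S$-closed sets $B$ with $0\in B$ and $\#B=i$. Define $f_\gamma:=\sum_{S\in\mathcal{S}_\gamma}\#C(S,\gamma+1)$. *)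

(* Defs.v *)
From mathcomp Require Import all_boot finmap.
From mathcomp Require Import boolp classical_sets functions cardinality fsbigop.

Set Implicit Arguments.
Unset Strict Implicit.
Unset Printing Implicit Defensive.

Local Open Scope classical_set_scope.

(* [fset_set A] is empty when A is infinite; every set counted below is finite,
   see [finite_even_gaps], [finite_semigroups] and [finite_closed_sets]. *)
Definition ncard (T : choiceType) (A : set T) : nat := #|` fset_set A|.

Definition gaps (S : set nat) : set nat := ~` S.

Definition numerical_semigroup (S : set nat) : Prop :=
  [/\ S 0, (forall x y, S x -> S y -> S (x + y)) & finite_set (gaps S)].

Definition genus (S : set nat) : nat := ncard (gaps S).

Definition even_gaps (S : set nat) : set nat :=
  [set x | gaps S x /\ ~~ odd x].

Definition semigroups (g : nat) : set (set nat) :=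
  [set S | numerical_semigroup S /\ genus S = g].

Definition N_even (gamma g : nat) : nat :=
  ncard [set S | semigroups g S /\ ncard (even_gaps S) = gamma].

(* The bigop \max is the maximum of a nonempty B (and 0 on the empty set). *)
Definition S_closed (S : set nat) (B : {fset nat}) : Prop :=
  forall b s, b \in B -> S s -> b + s \in B \/ \max_(x <- B) x < b + s.

Definition closed_sets (S : set nat) (i : nat) : set {fset nat} :=
  [set B | [/\ S_closed S B, 0 \in B & #|` B| = i]].

Definition f_closed (gamma : nat) : nat :=
  \big[addn/0]_(S \in semigroups gamma) ncard (closed_sets S gamma.+1).

Lemma finite_even_gaps S : numerical_semigroup S -> finite_set (even_gaps S).
Proof. by case=> _ _; apply: sub_finite_set => x []. Qed.

Lemma gap_lt_double_genus S x :
  numerical_semigroup S -> gaps S x -> x < genus S + genus S.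
Proof.
move=> [_ SD finS] xS; pose G : seq nat := fset_set (gaps S).
have GP y : y \in G <-> gaps S y.
  by rewrite /G in_fset_set// inE.
rewrite /genus /ncard -/G -[in X in _ < _ + X](size_map (subn x)) -size_cat.
rewrite -[x.+1](size_iota 0); apply: uniq_leq_size; first exact: iota_uniq.
move=> a; rewrite mem_iota add0n ltnS /= => ax; rewrite mem_cat.
have [aS|aS] := pselect (S a); last by apply/orP; left; apply/GP.
apply/orP; right; apply/mapP; exists (x - a); last by rewrite subKn.
by apply/GP => xaS; apply: xS; rewrite -(subnKC ax); exact: SD.
Qed.

Lemma finite_semigroups g : finite_set (semigroups g).
Proof.
pose P := fpowerset [fset x in iota 0 (g + g)]%fset.
apply: (@sub_finite_set _ _ ((fun X : {fset nat} => ~` [set` X]) @` [set` P])).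
  move=> S [semS genS]; exists (fset_set (gaps S)); last first.
    by rewrite fset_setK ?setCK//; case: semS.
  rewrite /= fpowersetE; apply/fsubsetP => x.
  rewrite in_fset_set ?inE; last by case: semS.
  rewrite mem_iota -genS => xS; exact: gap_lt_double_genus.
exact/finite_image/finite_fset.
Qed.

Lemma finite_closed_sets S i : numerical_semigroup S -> finite_set (closed_sets S i).
Proof.
move=> [S0 SD finS]; pose G : seq nat := fset_set (gaps S).
pose P := fpowerset [fset x in iota 0 (size G + i)]%fset.
apply: (@sub_finite_set _ _ [set` P]); last exact: finite_fset.
move=> B [clB B0 cardB]; rewrite /= fpowersetE; apply/fsubsetP => x xB.
have mB : x <= \max_(y <- B) y by apply: (leq_bigmax_seq (F := id)).
rewrite !inE /= mem_iota add0n /=; apply: leq_ltn_trans mB _.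
rewrite -cardB -size_cat -[X in X <= _](size_iota 0).
apply: uniq_leq_size; first exact: iota_uniq.
move=> a; rewrite mem_iota add0n ltnS /= => am; rewrite mem_cat.
have [aS|aS] := pselect (S a); apply/orP; last first.
  by left; rewrite /G in_fset_set// inE.
by right; have [|] := clB _ _ B0 aS; rewrite add0n// ltnNge am.
Qed.

(* Main.v *)
Require Import Defs.
From mathcomp Require Import all_boot finmap zify.
From mathcomp Require Import boolp classical_sets functions cardinality fsbigop.

Set Implicit Arguments.
Unset Strict Implicit.
Unset Printing Implicit Defensive.

Local Open Scope classical_set_scope.

(** Split a numerical semigroup [T] by parity: [S = T/2] is a numerical
    semigroup and [K = {k | 2k+1 \in T}] is an ideal over it ([K + S] is
    contained in [K]).  The even gaps of [T] are the doubles of the gaps of [S],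
    so [T] has [gamma] even gaps exactly when [S] has genus [gamma], and then
    [K] has [g - gamma] gaps if [T] has genus [g].  Conversely such a pair
    [(S, K)] comes from a semigroup as soon as [k + l + 1 \in S] for all
    [k, l \in K].

    This last condition holds automatically when [3 gamma <= g].  Write
    [K = m + L] with [0 \in L].  Then [L] contains [S], so it has at most
    [gamma] gaps; as [K] has [m] more gaps than [L],
    [m >= g - 2 gamma >= gamma], and [k + l + 1 > 2 gamma] exceeds every gap of
    [S].  Moreover [m] is determined by [g], [gamma] and [L].  Hence the
    semigroups of genus [g] with even part [S] correspond to the ideals [L] of
    [S] with least element [0] ([image_assemble]), whatever [g >= 3 gamma] is.

    These ideals correspond in turn to the closed sets [B] of size [gamma + 1]
    containing [0], via [B |-> B + (max B, oo)] ([image_extend]).  A gap [x] of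
    an ideal [L] with [n] gaps satisfies [x < gamma + n] ([ideal_gap_lt]), so
    [L] is recovered from its elements up to [gamma + n], of which there are
    [gamma + n + 1 - n = gamma + 1].  Summing over [S] gives the theorem. *)

(** * Cardinals of finite sets *)

Lemma finite_bounded n (A : set nat) : (forall x, A x -> x < n) -> finite_set A.
Proof. by move=> An; apply: sub_finite_set (finite_II n) => x /An. Qed.

Lemma ncard_image (T U : choiceType) (f : T -> U) (A : set T) :
  finite_set A -> {in A &, injective f} -> ncard (f @` A) = ncard A.
Proof.
move=> finA injf; rewrite /ncard fset_set_image// card_in_imfset//.
by move=> x y /= xA yA; apply: injf; rewrite -in_fset_set.
Qed.

Lemma ncardU (T : choiceType) (A B : set T) :
  finite_set A -> finite_set B -> (forall x, A x -> ~ B x) ->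
  ncard (A `|` B) = ncard A + ncard B.
Proof.
move=> finA finB disj; rewrite /ncard fset_setU// cardfsU -fset_setI//.
by rewrite (_ : A `&` B = set0) ?fset_set0 ?cardfs0 ?subn0// -subset0 => x [/disj].
Qed.

Lemma ncard_sub (T : choiceType) (A B : set T) :
  finite_set B -> A `<=` B -> ncard A <= ncard B.
Proof.
move=> finB AB; apply: fsubset_leq_card; rewrite -fset_set_sub//.
exact: sub_finite_set finB.
Qed.

Lemma ncard_II n : ncard `I_n = n.
Proof. exact: card_fset_set. Qed.

Lemma ncard_fibers (T U : choiceType) (h : T -> U) (A : set T) (D : set U) :
  finite_set A -> finite_set D -> (forall x, A x -> D (h x)) ->
  ncard A = \big[addn/0]_(y \in D) ncard (A `&` [set x | h x = y]).
Proof.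
move=> finA finD AD; rewrite fsbig_finite// /ncard card_fset_sum1.
transitivity (\sum_(x <- fset_set A) \sum_(y <- fset_set D | h x == y) 1).
  apply: eq_big_seq => x; rewrite in_fset_set// inE => /AD Dhx.
  rewrite sum1_count (eq_count (a2 := pred1 (h x))); last by move=> y /=; rewrite eq_sym.
  by rewrite count_uniq_mem ?fset_uniq// in_fset_set// mem_set.
rewrite (exchange_big_dep xpredT)//=; apply: eq_bigr => y _.
rewrite sum1_count -size_filter; apply: perm_size; apply: uniq_perm.
- exact/filter_uniq/fset_uniq.
- exact: fset_uniq.
move=> x; rewrite mem_filter in_fset_set// in_fset_set; last first.
  by apply: sub_finite_set finA => z [].
by rewrite in_setI andbC; congr (_ && _); apply/eqP/idP; rewrite inE.
Qed.

(** * Ideals of a numerical semigroup *)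

Definition ideal (S L : set nat) : Prop := forall x s, L x -> S s -> L (x + s).

(** Up to translation, these are all the nonempty ideals of [S] in the natural
    numbers: normalised to have least element [0]. *)
Definition normal_ideals (S : set nat) : set (set nat) :=
  [set L | ideal S L /\ L 0].

Lemma normal_ideal_gaps S L : normal_ideals S L -> gaps L `<=` gaps S.
Proof. by move=> [idL L0] x Lx Sx; apply: Lx; rewrite -[x]add0n; apply: idL. Qed.

(** Among [0, ..., x] there are at most [ncard (gaps L)] gaps of [L].  If [y] is
    one of the remaining numbers, that is [y] lies in [L], then [x - y] is a gap
    of [S], for otherwise [x] would be in [L]; so there are at most [genus S] of
    those.  For [L = S] this is the bound of the largest gap by twice the
    genus. *)
Lemma ideal_gap_lt S L x :
  numerical_semigroup S -> ideal S L -> finite_set (gaps L) -> gaps L x ->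
  x < genus S + ncard (gaps L).
Proof.
move=> [_ _ finS] idL finL Lx.
have split_I : `I_x.+1 = (L `&` `I_x.+1) `|` (gaps L `&` `I_x.+1).
  by rewrite -setIUl setUv setTI.
have finI (A : set nat) : finite_set (A `&` `I_x.+1).
  by apply: (@finite_bounded x.+1) => y [].
rewrite -[x.+1]ncard_II split_I ncardU//; last by move=> y [Ly _] [].
apply: leq_add; last by apply: ncard_sub => // y [].
(* [y |-> x - y] injects the elements of [L] up to [x] into the gaps of [S] *)
rewrite -(@ncard_image _ _ (subn x))//; last first.
  by move=> y z; rewrite !inE /= => -[_ yx] [_ zx]; lia.
apply: ncard_sub => // _ [y [Ly /= yx] <-] Sxy; apply: Lx.
by rewrite -(subnKC (n := x) (m := y))//; exact: idL.
Qed.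

(** * Closed sets as truncated ideals *)

(** The largest set whose truncation at [max B] is [B]. *)
Definition extend (B : {fset nat}) : set nat :=
  [set x | x \in B \/ \max_(y <- B) y < x].

Lemma leq_fset_max (B : {fset nat}) x : x \in B -> x <= \max_(y <- B) y.
Proof. by move=> xB; apply: (leq_bigmax_seq (F := id)). Qed.

Lemma finite_gaps_extend B : finite_set (gaps (extend B)).
Proof.
apply: (@finite_bounded (\max_(y <- B) y).+1) => x Bx; rewrite ltnNge.
by apply/negP => ltx; apply: Bx; right.
Qed.

(** No gap of [extend B] exceeds [max B], so the gaps are complementary to [B] in
    [0, ..., max B].  Thus the size of [B] and the number of gaps of [extend B]
    determine [max B], which is why [extend] is injective on sets of a fixed
    size. *)
Lemma ncard_gaps_extend B :
  ncard (gaps (extend B)) + #|` B| = (\max_(y <- B) y).+1.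
Proof.
rewrite -[RHS]ncard_II (_ : `I__ = gaps (extend B) `|` [set` B]).
  rewrite ncardU ?/ncard ?set_fsetK//; first exact: finite_gaps_extend.
  by move=> x Bx /= xB; apply: Bx; left.
apply/seteqP; split=> x /=; last first.
  case=> [Bx|/leq_fset_max//]; rewrite ltnNge; apply/negP => ltx.
  by apply: Bx; right.
rewrite ltnS => xm; have [xB|xB] := boolP (x \in B); [by right|left].
by move=> -[|]; [rewrite (negPf xB)|rewrite ltnNge xm].
Qed.

Lemma extend_inj B B' : #|` B| = #|` B'| -> extend B = extend B' -> B = B'.
Proof.
move=> eqc eqe; have eqm : \max_(y <- B) y = \max_(y <- B') y.
  by apply: succn_inj; rewrite -!ncard_gaps_extend eqe eqc.
have memE (C : {fset nat}) x : x \in C <-> extend C x /\ x <= \max_(y <- C) y.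
  split=> [xC|[[//|]]]; first by split; [left|exact: leq_fset_max].
  by rewrite ltnNge => /negbTE->.
by apply/fsetP => x; apply/idP/idP => /memE ?; apply/memE;
  [rewrite -eqe -eqm|rewrite eqe eqm].
Qed.

(** To reach an ideal [L] with [n] gaps, truncate it at [M = genus S + n].  By
    [ideal_gap_lt] every number from [M] on is in [L], so [M] is the maximum of
    the truncation, nothing is lost above [M], and the truncation has
    [M + 1 - n = genus S + 1] elements. *)
Lemma image_extend S : numerical_semigroup S ->
  extend @` closed_sets S (genus S).+1 = normal_ideals S.
Proof.
move=> semS; apply/seteqP; split=> [_ [B [clB B0 _] <-]|L [idL L0]].
  split; last by left.
  move=> x s [xB|ltx] Ss; first exact: clB.
  by right; exact: leq_trans ltx (leq_addr _ _).
have finL : finite_set (gaps L).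
  by case: semS => _ _; apply: sub_finite_set; exact: normal_ideal_gaps.
set M := genus S + ncard (gaps L).
have L_large x : M <= x -> L x.
  by rewrite leqNgt => /negP ltx; apply: contrapT => /(ideal_gap_lt semS idL finL).
have memB x : x \in fset_set (L `&` `I_M.+1) <-> L x /\ x <= M.
  rewrite in_fset_set ?inE//; apply: (@finite_bounded M.+1) => y [] //.
pose B := fset_set (L `&` `I_M.+1).
have maxB : \max_(y <- B) y = M.
  apply/eqP; rewrite eqn_leq leq_fset_max ?andbT; last by apply/memB; split; auto.
  by apply/bigmax_leqP_seq => y /memB[].
have extB : extend B = L.
  apply/seteqP; split=> x; rewrite /extend /= maxB.
    by case=> [/memB[]|/ltnW/L_large].
  by move=> Lx; case: (leqP x M) => xM; [left; apply/memB|right].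
exists B => //; split; first 2 last.
- by have := ncard_gaps_extend B; rewrite extB maxB /M; lia.
- move=> b s /memB[Lb _] Ss; suff : extend B (b + s) by [].
  by rewrite extB; exact: idL.
- by apply/memB.
Qed.

Lemma finite_normal_ideals S : numerical_semigroup S -> finite_set (normal_ideals S).
Proof.
by move=> semS; rewrite -image_extend//; exact/finite_image/finite_closed_sets.
Qed.

Lemma ncard_closed_sets S : numerical_semigroup S ->
  ncard (closed_sets S (genus S).+1) = ncard (normal_ideals S).
Proof.
move=> semS; rewrite -image_extend// ncard_image//; first exact: finite_closed_sets.
move=> B B'; rewrite !inE => -[_ _ cB] [_ _ cB'].
by apply: extend_inj; rewrite cB cB'.
Qed.

(** * Even and odd parts of a numerical semigroup *)

Definition even_part (T : set nat) : set nat := [set s | T s.*2].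
Definition odd_part (T : set nat) : set nat := [set k | T k.*2.+1].
Definition interleave (S K : set nat) : set nat :=
  [set x | if odd x then K x./2 else S x./2].

Lemma even_part_interleave S K : even_part (interleave S K) = S.
Proof. by apply/seteqP; split=> x; rewrite /even_part /interleave /= odd_double doubleK. Qed.

Lemma odd_part_interleave S K : odd_part (interleave S K) = K.
Proof.
by apply/seteqP; split=> x; rewrite /odd_part /interleave /= odd_double /= uphalf_double.
Qed.

Lemma interleave_parts T : interleave (even_part T) (odd_part T) = T.
Proof.
apply/seteqP; split=> x; rewrite /even_part /odd_part /interleave /=;
  case: ifPn => parx; rewrite ?(odd_halfK parx) ?(even_halfK parx) //;
  by rewrite prednK// odd_gt0.
Qed.

Lemma even_gaps_image T : even_gaps T = double @` gaps (even_part T).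
Proof.
apply/seteqP; split=> [x [Tx ev]|_ [y Ty <-]]; last by split; rewrite ?odd_double.
by exists x./2; rewrite /gaps /even_part /= ?even_halfK.
Qed.

Lemma ncard_even_gaps T : finite_set (gaps (even_part T)) ->
  ncard (even_gaps T) = genus (even_part T).
Proof. by move=> fin; rewrite even_gaps_image ncard_image// => x y _ _; exact: double_inj. Qed.

Lemma gaps_split T : gaps T =
  (double @` gaps (even_part T)) `|` ((fun k => k.*2.+1) @` gaps (odd_part T)).
Proof.
apply/seteqP; split=> [x Tx|_ [|] [y Ty <-]//].
have [od|ev] := boolP (odd x).
  by right; exists x./2; rewrite /gaps /odd_part /= ?odd_halfK ?prednK//; case: x od Tx.
by left; exists x./2; rewrite /gaps /even_part /= ?even_halfK.
Qed.

Lemma finite_gaps_parts T : finite_set (gaps (even_part T)) ->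
  finite_set (gaps (odd_part T)) -> finite_set (gaps T).
Proof. by move=> fe fo; rewrite gaps_split finite_setU; split; exact: finite_image. Qed.

Lemma genus_parts T : finite_set (gaps (even_part T)) ->
  finite_set (gaps (odd_part T)) ->
  genus T = genus (even_part T) + ncard (gaps (odd_part T)).
Proof.
move=> fe fo; rewrite {1}/genus gaps_split ncardU; last first.
- by move=> _ [x _ <-] [y _] /(congr1 odd); rewrite /= !odd_double.
- exact: finite_image.
- exact: finite_image.
by congr (_ + _); apply: ncard_image => // x y _ _; [exact: double_inj|case=> /double_inj].
Qed.

Lemma even_part_semigroup T : numerical_semigroup T -> numerical_semigroup (even_part T).
Proof.
move=> [T0 TD finT]; split=> //.
  by move=> x y; rewrite /even_part /= doubleD; exact: TD.
by apply: (finite_preimage (f := double)) finT => x y _ _; exact: double_inj.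
Qed.

Lemma odd_part_ideal T : numerical_semigroup T -> ideal (even_part T) (odd_part T).
Proof.
move=> [_ TD _] x s; rewrite /even_part /odd_part /= doubleD -addSn; exact: TD.
Qed.

Lemma finite_gaps_odd_part T :
  numerical_semigroup T -> finite_set (gaps (odd_part T)).
Proof.
move=> [_ _ finT]; apply: (finite_preimage (f := fun k => k.*2.+1)) finT.
by move=> x y _ _ [] /double_inj.
Qed.

(** The three parity patterns of a sum require [S] to be closed under addition,
    [K] to be an ideal, and, since [(2k+1) + (2l+1) = 2(k+l+1)], the last
    hypothesis. *)
Lemma interleave_semigroup S K :
  numerical_semigroup S -> ideal S K -> finite_set (gaps K) ->
  (forall k l, K k -> K l -> S (k + l).+1) ->
  numerical_semigroup (interleave S K).
Proof.
move=> [S0 SD finS] idK finK SK; split=> //; last first.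
  by apply: finite_gaps_parts; rewrite ?even_part_interleave ?odd_part_interleave.
move=> x y; rewrite /interleave /= oddD halfD.
case: (odd x) (odd y) => -[] /= Kx Ky; rewrite ?add0n ?add1n.
- exact: SK.
- exact: idK.
- by rewrite addnC; exact: idK.
- exact: SD.
Qed.

(** * Translates of ideals *)

Definition translate (m : nat) (L : set nat) : set nat :=
  [set k | m <= k /\ L (k - m)].

Lemma gaps_translate m L : gaps (translate m L) = `I_m `|` (addn m @` gaps L).
Proof.
apply/seteqP; split=> [k Lk|k [|[l Ll <-]] /=].
- have [mk|km] := leqP m k; last by left.
  right; exists (k - m); last exact: subnKC.
  by move=> Lkm; apply: Lk.
- by move=> km [mk _]; rewrite ltnNge mk in km.
- by rewrite /gaps /translate /= addKn => -[].
Qed.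

Lemma finite_gaps_translate m L :
  finite_set (gaps L) -> finite_set (gaps (translate m L)).
Proof.
by move=> finL; rewrite gaps_translate finite_setU; split=> //; exact: finite_image.
Qed.

Lemma ncard_gaps_translate m L : finite_set (gaps L) ->
  ncard (gaps (translate m L)) = m + ncard (gaps L).
Proof.
move=> finL; rewrite gaps_translate ncardU//; first last.
- by move=> x /= xm [l _ lx]; lia.
- exact: finite_image.
by rewrite ncard_II ncard_image// => x y _ _ /addnI.
Qed.

(** The least element of [translate m L] is [m], which gives back [m] and hence
    [L]. *)
Lemma translate_inj m m' L L' : L 0 -> L' 0 ->
  translate m L = translate m' L' -> L = L'.
Proof.
move=> L0 L'0 eqL; have mm' : m = m'.
  have [] : translate m' L' m by rewrite -eqL; split; rewrite ?subnn.
  have [] : translate m L m' by rewrite eqL; split; rewrite ?subnn.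
  lia.
rewrite -{m'}mm' in eqL.
have untranslate (N : set nat) : N = addn m @^-1` translate m N.
  by apply/seteqP; split=> x; rewrite /translate /= addKn leq_addr => // -[].
by rewrite (untranslate L) eqL -untranslate.
Qed.

Lemma translate_ideal S m L : ideal S L -> ideal S (translate m L).
Proof.
move=> idL x s [mx Lx] Ss; split; first exact: leq_trans mx (leq_addr _ _).
by rewrite -addnBAC//; exact: idL.
Qed.

Lemma ideal_translateP S K : ideal S K -> finite_set (gaps K) ->
  exists m L, normal_ideals S L /\ K = translate m L.
Proof.
move=> idK finK; have exK : exists k, `[< K k >].
  apply: contrapT => noK; apply: infinite_nat.
  apply: sub_finite_set finK => k _ Kk; apply: noK.
  by exists k; apply/asboolP.
case: (ex_minnP exK) => m /asboolP Km minm.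
exists m, [set x | K (m + x)]; split.
  by split=> [x s Kx Ss|] /=; rewrite ?addn0// addnA; exact: idK.
apply/seteqP; split=> [k Kk|k [mk]]; rewrite /translate /=; last by rewrite subnKC.
by have mk : m <= k by [exact/minm/asboolP]; rewrite subnKC.
Qed.

(** * Semigroups with a given even part *)

(** The translation amount is the one that makes the genus equal to [g]: the odd
    gaps must number [g - genus S], and those coming from [L] are
    [ncard (gaps L)].  For [L] in [normal_ideals S] and [3 * genus S <= g] no
    subtraction is truncated, because [ncard (gaps L) <= genus S]. *)
Definition assemble (g : nat) (S L : set nat) : set nat :=
  interleave S (translate (g - genus S - ncard (gaps L)) L).

(** The bound on [g] makes the translation amount at least [genus S], so that a
    sum of two odd elements is twice a number above all gaps of [S]. *)
Lemma image_assemble S g : numerical_semigroup S -> 3 * genus S <= g ->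
  assemble g S @` normal_ideals S = semigroups g `&` [set T | even_part T = S].
Proof.
move=> semS geg; have [S0 SD finS] := semS.
apply/seteqP; split=> [_ [L nL <-]|T [[semT genT] evT]].
  have [idL L0] := nL; have subLS := normal_ideal_gaps nL.
  have finL : finite_set (gaps L) by exact: sub_finite_set finS.
  have leLS : ncard (gaps L) <= genus S by exact: ncard_sub.
  split; last exact: even_part_interleave.
  have finT := finite_gaps_translate (g - genus S - ncard (gaps L)) finL.
  split.
    apply: interleave_semigroup => //; first exact: translate_ideal.
    move=> k l [mk _] [ml _]; apply: contrapT => /(gap_lt_double_genus semS).
    lia.
  rewrite genus_parts ?even_part_interleave ?odd_part_interleave//.
  by rewrite ncard_gaps_translate//; lia.
have finK := finite_gaps_odd_part semT.
have idK := odd_part_ideal semT; rewrite evT in idK.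
have [m [L [nL KE]]] := ideal_translateP idK finK.
have finL : finite_set (gaps L) by exact: sub_finite_set (normal_ideal_gaps nL) finS.
exists L => //; rewrite -[RHS]interleave_parts evT KE /assemble.
have := genT; rewrite genus_parts ?evT// KE ncard_gaps_translate// => <-.
by rewrite addKn addnK.
Qed.

Lemma ncard_semigroups_even_part S g : numerical_semigroup S -> 3 * genus S <= g ->
  ncard (semigroups g `&` [set T | even_part T = S]) = ncard (closed_sets S (genus S).+1).
Proof.
move=> semS geg; rewrite -image_assemble// ncard_closed_sets// ncard_image//.
  exact: finite_normal_ideals.
move=> L L'; rewrite !inE => -[_ L0] [_ L'0] /(congr1 odd_part).
by rewrite !odd_part_interleave; exact: translate_inj.
Qed.

(** The right-hand side is counted by the fibers of [even_part], which maps the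
    semigroups with [gamma] even gaps to those of genus [gamma]. *)
Lemma f_closed_eq_N_even gamma g : 3 * gamma <= g -> f_closed gamma = N_even gamma g.
Proof.
move=> geg; have finD := finite_semigroups gamma.
rewrite /N_even (ncard_fibers (h := even_part) (D := semigroups gamma))//; first last.
- move=> T [[semT _] <-]; have semS := even_part_semigroup semT.
  by split=> //; rewrite ncard_even_gaps//; case: semS.
- by apply: sub_finite_set (finite_semigroups g) => T [].
apply: eq_fsbigr => S; rewrite inE => -[semS genS].
rewrite -genS -(@ncard_semigroups_even_part S g) ?genS//; congr ncard.
apply/seteqP; split=> T [semT evT]; split=> //; last by case: semT.
by split=> //; rewrite ncard_even_gaps evT//; case: semS.
Qed.

Theorem theorem4p4 (gamma : nat) : f_closed gamma = N_even gamma (3 * gamma).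
Proof. exact: f_closed_eq_N_even. Qed.
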